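(* Let $B>0$ and let $f$ be an arbitrary (randomized) truthful-in-expectation mechanism for the single-facility location game on the real line with doubly-peaked preferences (public locations, private preferred distances bounded by $B$). Then the additive approximation error of $f$ is at least $\frac{nB}{300}$; that is, there exists an instance $I$, with some number $n\ge 1$ of agents, such that $$\mathbb{E}_{y\sim f(I)}\big[SC(y,I)\big]\;\ge\; OPT(I)+\frac{nB}{300}.$$
   Context: An instance with $n$ agents is a tuple $I=\langle (x_1,b_1),\dots,(x_n,b_n)\rangle$, where $x_i\in\mathbb{R}$ is the publicly known location of agent $i$ and $b_i\in[0,B]$ is its private preferred distance to the facility. The cost of agent $i$ when the facility is at $y\in\mathbb{R}$ is $cost(y,(x_i,b_i))=|x_i-b_i-y|$ if $y\le x_i$ and $|x_i+b_i-y|$ if $y>x_i$ (equivalently $\big||x_i-y|-b_i\big|$). The social cost is $SC(y,I)=\sum_{i=1}^n cost(y,(x_i,b_i))$ and $OPT(I)=\min_{y\in\mathbb{R}}SC(y,I)$. A randomized mechanism $f$ maps every instance (with any number of agents) to a probability distribution $f(I)$ on $\mathbb{R}$ (the distribution of the facility location). It is truthful-in-expectation if for every instance $I$, every agent $i$ and every misreport $b_i'\in[0,B]$, $\mathbb{E}_{y\sim f(I)}[cost(y,(x_i,b_i))]\le \mathbb{E}_{y\sim f(I')}[cost(y,(x_i,b_i))]$, where $I'$ is $I$ with $(x_i,b_i)$ replaced by $(x_i,b_i')$. *)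

(* Defs.v *)
From HB Require Import structures.
From mathcomp Require Import all_boot all_order all_algebra.
From mathcomp Require Import lra.
From mathcomp Require Import all_classical all_reals all_analysis.

Set Implicit Arguments.
Unset Strict Implicit.
Unset Printing Implicit Defensive.

Import Order.TTheory GRing.Theory Num.Theory.
Import numFieldNormedType.Exports.

Local Open Scope classical_set_scope.
Local Open Scope ring_scope.

Definition pref_dist (R : realType) (B : R) : Type := {b : R | 0 <= b <= B}.

Definition instance (R : realType) (B : R) (n : nat) : Type :=
  {ffun 'I_n -> R * pref_dist B}.

Definition cost (R : realType) (y x b : R) : R :=
  if y <= x then `|x - b - y| else `|x + b - y|.

Definition agent_cost (R : realType) (B : R) (n : nat) (I : instance B n)
    (i : 'I_n) (y : R) : R :=
  cost y (I i).1 (val (I i).2).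

Definition SC (R : realType) (B : R) (n : nat) (I : instance B n) (y : R) : R :=
  \sum_(i < n) agent_cost I i y.

(* The infimum is attained, see OPT_min below. *)
Definition OPT (R : realType) (B : R) (n : nat) (I : instance B n) : R :=
  inf (range (SC I)).

Definition misreport (R : realType) (B : R) (n : nat) (I : instance B n)
    (i : 'I_n) (b' : pref_dist B) : instance B n :=
  [ffun j => if j == i then ((I i).1, b') else I j].

(* A single mechanism handles every number n of agents; the value is a Borel
   probability measure on R. *)
Definition mechanism (R : realType) (B : R) : Type :=
  forall n : nat, instance B n -> probability (measurableTypeR R) R.

(* Costs are nonnegative and continuous in y, so both expectations are always
   defined, with +oo as a possible value. *)
Definition truthful_in_expectation (R : realType) (B : R)
    (f : mechanism B) : Prop :=
  forall (n : nat) (I : instance B n) (i : 'I_n) (b' : pref_dist B),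
    ('E_(f n I)[agent_cost I i] <=
     'E_(f n (misreport I i b'))[agent_cost I i])%E.

Lemma costE (R : realType) (y x b : R) : cost y x b = `| `|x - y| - b |.
Proof.
rewrite /cost; case: ifPn => [yx|].
  by rewrite (@ger0_norm _ (x - y)) ?subr_ge0// addrAC.
rewrite -ltNge => xy; rewrite (@ltr0_norm _ (x - y)) ?subr_lt0//.
by rewrite -normrN; congr `| _ |; lra.
Qed.

Lemma continuous_SC (R : realType) (B : R) (n : nat) (I : instance B n) :
  continuous (SC I : R -> R).
Proof.
have -> : SC I = \sum_(i < n) agent_cost I i.
  by apply/funext => y; rewrite /SC fct_sumE.
apply: (big_ind (fun g : R -> R => continuous g)) => [|g h cg ch|i _] y.
- exact: cvg_cst.
- by apply: cvgD; [exact: cg | exact: ch].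
rewrite (_ : agent_cost I i = fun y => `| `|(I i).1 - y| - val (I i).2 |).
  apply: cvg_norm; apply: cvgB; last exact: cvg_cst.
  by apply: cvg_norm; apply: cvgB; [exact: cvg_cst | exact: cvg_id].
by apply/funext => z; rewrite /agent_cost costE.
Qed.

Lemma OPT_min (R : realType) (B : R) (n : nat) (I : instance B n) :
  exists2 y : R, SC I y = OPT I & forall z : R, OPT I <= SC I z.
Proof.
have SC0 z : 0 <= SC I z.
  by apply: sumr_ge0 => i _; rewrite /agent_cost costE.
have lbI : has_lbound (range (SC I)) by exists 0 => _ [z _ <-].
have leOPT z : OPT I <= SC I z by apply: ge_inf => //; exists z.
suff [y ymin] : exists y, forall z, SC I y <= SC I z.
  exists y => //; apply/eqP; rewrite eq_le leOPT andbT.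
  by apply: lb_le_inf; [exists (SC I 0), 0 | move=> _ [z _ <-]].
case: n I SC0 lbI leOPT => [I _ _ _|n I SC0 _ _].
  by exists 0 => z; rewrite /SC !big_ord0.
set M := SC I 0; set x := (I ord0).1; set b := val (I ord0).2.
have M0 : 0 <= M := SC0 0.
set r := `|x| + `|b| + M.
have r0 : 0 <= r by rewrite !addr_ge0.
have [y _ ymin] : exists2 c, c \in `[- r, r]%R &
    forall t, t \in `[- r, r]%R -> SC I c <= SC I t.
  apply: EVT_min; first by lra.
  apply: continuous_subspaceT; exact: continuous_SC.
exists y => z; have [zr|rz] := lerP `|z| r.
  by apply: ymin; rewrite in_itv/= -ler_norml.
apply: (@le_trans _ _ M).
  by apply: ymin; rewrite in_itv/= r0 andbT oppr_le0.
rewrite /SC big_ord_recl.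
apply: (@le_trans _ _ (agent_cost I ord0 z)); last first.
  by rewrite lerDl; apply: sumr_ge0 => i _; rewrite /agent_cost costE.
rewrite /agent_cost costE -/x -/b.
have := ler_norm (`|x - z| - b).
have := ler_norm b.
have := lerB_dist z x; rewrite distrC.
by move: rz; rewrite /r; lra.
Qed.

(* Main.v *)
Require Import Defs.
From mathcomp Require Import all_boot all_order all_algebra.
From mathcomp Require Import all_classical all_reals all_analysis.
From mathcomp Require Import measurable_realfun lra.

Import Order.TTheory GRing.Theory Num.Theory.
Local Open Scope ring_scope.

(* Take n = 3: one agent at B/2 with preferred distance B/2, and two voters at
   0.  The first agent ties the facility to the neighbourhood of 0 and B, so a
   nearly optimal mechanism amounts to a lottery between these two points, and
   by truthfulness this lottery can only depend on which point each voter
   prefers, not on the intensity of the preference.  When the voters have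
   preferred distances 0 and B, one of them has expected cost at least B/2.
   Weaken the preference of the other one, to distance 3B/4 instead of B or
   B/4 instead of 0: the lottery is essentially unchanged, but it is now
   clearly better to serve the losing voter, at social cost 3B/4. *)

Section Expectation.
Context {d : measure_display} {T : measurableType d} {R : realType}.
Context (P : probability T R).
Implicit Types (g h : T -> R) (a b k : R).

Lemma expectation_ge0_le g h :
  measurable_fun setT g -> measurable_fun setT h ->
  (forall y, 0 <= g y) -> (forall y, g y <= h y) -> ('E_P[g] <= 'E_P[h])%E.
Proof.
move=> mg mh g0 gh; apply: expectation_le => //; last exact/aeW.
by move=> y; exact: le_trans (gh y).
Qed.

Lemma expectation_ge0D g h :
  measurable_fun setT g -> measurable_fun setT h ->
  (forall y, 0 <= g y) -> (forall y, 0 <= h y) ->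
  ('E_P[fun y => (g y + h y)%R] = 'E_P[g] + 'E_P[h])%E.
Proof.
move=> mg mh g0 h0; rewrite unlock -ge0_integralD //.
- by move=> y _; rewrite lee_fin.
- exact/measurable_EFinP.
- by move=> y _; rewrite lee_fin.
- exact/measurable_EFinP.
Qed.

Lemma expectation_ge0Z k g :
  measurable_fun setT g -> 0 <= k -> (forall y, 0 <= g y) ->
  ('E_P[fun y => (k * g y)%R] = k%:E * 'E_P[g])%E.
Proof.
move=> mg k0 g0; rewrite unlock -ge0_integralZl_EFin //.
- by move=> y _; rewrite lee_fin.
- exact/measurable_EFinP.
Qed.

(** Nonnegativity replaces integrability, because expected costs may be [+oo]. Pointwise linear
    inequalities between costs pass to expectations through this identity. *)
Lemma expectation_ge0_affine a b k g h :
  measurable_fun setT g -> measurable_fun setT h ->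
  0 <= a -> 0 <= b -> 0 <= k ->
  (forall y, 0 <= g y) -> (forall y, 0 <= h y) ->
  ('E_P[fun y => (a * g y + b * h y + k)%R]
   = a%:E * 'E_P[g] + b%:E * 'E_P[h] + k%:E)%E.
Proof.
move=> mg mh a0 b0 k0 g0 h0.
have mag : measurable_fun setT (fun y => a * g y) by exact: measurable_funM.
have mbh : measurable_fun setT (fun y => b * h y) by exact: measurable_funM.
have ag0 y : 0 <= a * g y by exact: mulr_ge0.
have bh0 y : 0 <= b * h y by exact: mulr_ge0.
rewrite (@expectation_ge0D (fun y => a * g y + b * h y) (cst k))//.
- by rewrite expectation_ge0D// !expectation_ge0Z// expectation_cst.
- exact: measurable_funD.
- by move=> y; exact: addr_ge0.
Qed.

End Expectation.

Section Costs.
Context {R : realType} {B : R} {n : nat}.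
Implicit Type I : instance B n.

Lemma agent_cost_ge0 I i y : 0 <= agent_cost I i y.
Proof. by rewrite /agent_cost costE. Qed.

Lemma SC_ge0 I y : 0 <= SC I y.
Proof. by apply: sumr_ge0 => i _; exact: agent_cost_ge0. Qed.

Lemma measurable_SC I :
  measurable_fun (setT : set (measurableTypeR R)) (SC I).
Proof. by apply: continuous_measurable_fun; exact: continuous_SC. Qed.

Lemma measurable_agent_cost I i :
  measurable_fun (setT : set (measurableTypeR R)) (agent_cost I i).
Proof.
rewrite (_ : agent_cost I i = fun y => `| `|(I i).1 - y| - val (I i).2 |).
  apply: measurableT_comp => //; apply: measurable_funB => //.
  by apply: measurableT_comp => //; exact: measurable_funB.
by apply/funext => y; rewrite /agent_cost costE.
Qed.

Lemma OPT_le I y : OPT I <= SC I y.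
Proof. by have [z _] := OPT_min I; apply. Qed.

End Costs.

(* [i] is the voter on the losing side in [I]; his opponent [j] is weak in [J]. *)
Lemma weak_opponent_bound (R : realType) (B : R) (n : nat) (f : mechanism B)
    (I J : instance B n) (i j : 'I_n) (b : pref_dist B) :
  0 < B -> truthful_in_expectation f -> I = misreport J j b ->
  ('E_(f n I)[SC I] <= (B + B / 100)%:E)%E ->
  ((B / 2)%:E <= 'E_(f n I)[agent_cost I i])%E ->
  (forall y, 2 * agent_cost J j y + agent_cost I i y + 3 / 2 * B
             <= 3 * SC I y) ->
  (forall y, 3 * B <= 3 * SC J y + agent_cost J j y) ->
  ((3 / 4 * B + B / 100)%:E <= 'E_(f n J)[SC J])%E.
Proof.
move=> B0 hf eIJ SI pI upper lower.
(* In [J] the weak agent [j] must not gain by reporting [b], which leads to [I]. *)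
have dev := hf n J j b; rewrite -eIJ in dev.
have [mI mJ] := (@measurable_agent_cost R B n I i,
                 @measurable_agent_cost R B n J j).
have [mSI mSJ] := (@measurable_SC R B n I, @measurable_SC R B n J).
have cI := @agent_cost_ge0 R B n I i.
have cJ := @agent_cost_ge0 R B n J j.
have sI := @SC_ge0 R B n I; have sJ := @SC_ge0 R B n J.
have {upper} : (2%:E * 'E_(f n I)[agent_cost J j]
    + 1%:E * 'E_(f n I)[agent_cost I i]
    + (3 / 2 * B)%:E <= 3%:E * 'E_(f n I)[SC I])%E.
  rewrite -expectation_ge0_affine// -?expectation_ge0Z//; last by lra.
  apply: expectation_ge0_le => [||y|y].
  - apply: measurable_funD => //; apply: measurable_funD;
      exact: measurable_funM.
  - exact: measurable_funM.
  - have := cI y; have := cJ y; lra.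
  - by rewrite mul1r; exact: upper.
have {lower} : ((3 * B)%:E <= 3%:E * 'E_(f n J)[SC J]
    + 1%:E * 'E_(f n J)[agent_cost J j] + 0%:E)%E.
  rewrite -expectation_ge0_affine// -(expectation_cst (f n J)).
  apply: expectation_ge0_le => [||y|y] //.
  - apply: measurable_funD => //; apply: measurable_funD;
      exact: measurable_funM.
  - by move: (lower y); rewrite /=; lra.
  - by move: (lower y); rewrite /=; lra.
have := expectation_ge0 (f n J) sJ; have := expectation_ge0 (f n J) cJ.
have := expectation_ge0 (f n I) cJ; have := expectation_ge0 (f n I) sI.
(* Only [SC I] is finite in expectation by assumption. The first inequality then makes both agent
   costs under [f n I] finite, and [dev] does so for [j] under [f n J]. If [SC J] has infinite
   expectation, the goal is trivial. *)
case: ('E_(f n I)[SC I])%E SI => [s|//|//] SI _.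
case: ('E_(f n I)[agent_cost J j])%E dev => [q||//] dev _; last first.
  by case: ('E_(f n I)[agent_cost I i])%E pI => [p||//] _ _ _;
    rewrite mulry gtr0_sg// !mul1e -EFinM.
case: ('E_(f n I)[agent_cost I i])%E pI => [p||//] pI; last first.
  by move=> _ _ _; rewrite mul1e.
case: ('E_(f n J)[agent_cost J j])%E dev => [r|//|//] dev _.
case: ('E_(f n J)[SC J])%E => [t _|_ _ _|//]; last by rewrite leey.
(* In units of [B]: [r <= q <= (3.03 - 1.5 - 0.5) / 2 = 0.515], hence [t >= (3 - 0.515) / 3 > 0.82],
   which exceeds 0.76. *)
move: SI pI dev; rewrite -!EFinM -!EFinD !lee_fin; lra.
Qed.

Section Voters.
Context {R : realType} {B : R}.
Implicit Types b c : pref_dist B.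

(** The distance [m] of the agent at [B / 2] is a parameter because [B / 2] belongs to [pref_dist B]
    only once [0 <= B] is known. *)
Definition voters (m b0 b1 : pref_dist B) : instance B 3 :=
  [ffun i : 'I_3 => if i == 0 then (0, b0) else
                    if i == 1 then (0, b1) else (B / 2, m)].

Lemma agent_cost_voter0 m b0 b1 y :
  agent_cost (voters m b0 b1) 0 y = `| `|y| - val b0 |.
Proof. by rewrite /agent_cost costE ffunE/= sub0r normrN. Qed.

Lemma agent_cost_voter1 m b0 b1 y :
  agent_cost (voters m b0 b1) 1 y = `| `|y| - val b1 |.
Proof. by rewrite /agent_cost costE ffunE/= sub0r normrN. Qed.

Lemma SC_voters m b0 b1 y : SC (voters m b0 b1) y =
  `| `|y| - val b0 | + `| `|y| - val b1 | + `| `|B / 2 - y| - val m |.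
Proof.
rewrite /SC !big_ord_recl big_ord0 addr0 addrA.
rewrite -(@agent_cost_voter0 m b0 b1) -(@agent_cost_voter1 m b0 b1).
congr (agent_cost _ _ _ + agent_cost _ _ _ + _); first exact: val_inj.
by rewrite /agent_cost costE ffunE.
Qed.

Lemma misreport_voter0 m b0 b1 b :
  misreport (voters m b0 b1) 0 b = voters m b b1.
Proof. by apply/ffunP => i; rewrite !ffunE/=; case: eqP => // ->. Qed.

Lemma misreport_voter1 m b0 b1 b :
  misreport (voters m b0 b1) 1 b = voters m b0 b.
Proof. by apply/ffunP => i; rewrite !ffunE/=; case: eqP => // ->. Qed.

End Voters.

(** The cost of the agent at [B / 2] is the distance from [y] to the nearer of its peaks 0 and [B].
    The bounds use [y] only through [|y|], which is all that voters at 0 see. *)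
Lemma center_cost_ge (R : realType) (B y : R) : 0 < B ->
  `|y| <= `| `|B / 2 - y| - B / 2 | \/
  `| `|y| - B | <= `| `|B / 2 - y| - B / 2 |.
Proof.
move=> B0; have [y0|y0] := ger0P y; have [z0|z0] := ger0P (B / 2 - y).
- by left; have [w|w] := ger0P (B / 2 - y - B / 2); lra.
- by right; have [w|w] := ger0P (- (B / 2 - y) - B / 2);
    have [v|v] := ger0P (y - B); lra.
- by left; have [w|w] := ger0P (B / 2 - y - B / 2); lra.
- by lra.
Qed.

(** Here [t] is [|y|] and [c] the cost of the agent at [B / 2]. With [c = 0], the first and third
    inequalities are equalities at both [t = 0] and [t = B], so they lose nothing on a lottery
    between the peaks; the second is tight at 0 and the fourth at [B]. *)
Lemma voter_cost_ineqs (R : realType) (B t c : R) :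
  0 < B -> 0 <= t -> t <= c \/ `|t - B| <= c ->
  [/\ 2 * `|t - 3 / 4 * B| + t + 3 / 2 * B <= 3 * (t + `|t - B| + c),
      3 * B <= 3 * (t + `|t - 3 / 4 * B| + c) + `|t - 3 / 4 * B|,
      2 * `|t - B / 4| + `|t - B| + 3 / 2 * B <= 3 * (t + `|t - B| + c) &
      3 * B <= 3 * (`|t - B / 4| + `|t - B| + c) + `|t - B / 4|].
Proof.
move=> B0 t0; have [u|u] := ger0P (t - B);
  have [v|v] := ger0P (t - B / 4); have [w|w] := ger0P (t - 3 / 4 * B);
  by case=> tc; split; lra.
Qed.

Theorem theorem2 (R : realType) (B : R) (hB : 0 < B) (f : mechanism B)
    (hf : truthful_in_expectation f) :
  exists (n : nat) (I : instance B n),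
    (1 <= n)%N /\
    ((OPT I + n%:R * B / 300)%:E <= 'E_(f n I)[SC I])%E.
Proof.
have hB2 : 0 < B / 2 by lra.
have h0 : 0 <= (0 : R) <= B by lra.
have h1 : 0 <= B / 4 <= B by lra.
have h2 : 0 <= B / 2 <= B by lra.
have h3 : 0 <= 3 / 4 * B <= B by lra.
have h4 : 0 <= B <= B by lra.
pose q (b : R) (hb : 0 <= b <= B) : pref_dist B := exist _ b hb.
pose I := voters (q _ h2) (q _ h0) (q _ h4).
have cI0 y : agent_cost I 0 y = `|y|.
  by rewrite agent_cost_voter0/= subr0 normr_id.
have cI1 y : agent_cost I 1 y = `| `|y| - B | by exact: agent_cost_voter1.
have SCI y : SC I y = `|y| + `| `|y| - B | + `| `|B / 2 - y| - B / 2 |.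
  by rewrite SC_voters/= subr0 normr_id.
have ineqs y :=
  voter_cost_ineqs _ _ _ _ hB (normr_ge0 y) (center_cost_ge _ _ y hB).
have [?|SI] := leP (OPT I + 3%:R * B / 300)%R%:E ('E_(f _ I)[SC I])%E.
  by exists 3%N, I.
(* At 0 only voter 1 pays, so [OPT I <= B]; the allowed error is [3 * B / 300 = B / 100]. *)
have {}SI : ('E_(f _ I)[SC I] <= (B + B / 100)%:E)%E.
  apply: (le_trans (ltW SI)); rewrite lee_fin.
  have := OPT_le I 0; rewrite SCI normr0 !(sub0r, subr0) normrN.
  by rewrite (gtr0_norm hB) (gtr0_norm hB2) subrr normr0; lra.
(* The two voters together pay at least [B] at every [y], so one of them expects to pay at least
   [B / 2]. *)
have : (B%:E <= 1%:E * 'E_(f _ I)[agent_cost I 0%R]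
    + 1%:E * 'E_(f _ I)[agent_cost I 1%R] + 0%:E)%E.
  have m0 := @measurable_agent_cost R B 3 I 0.
  have m1 := @measurable_agent_cost R B 3 I 1.
  have c0 := @agent_cost_ge0 R B 3 I 0.
  have c1 := @agent_cost_ge0 R B 3 I 1.
  rewrite -expectation_ge0_affine// -(expectation_cst (f _ I)).
  apply: expectation_ge0_le => [||y|y] //.
  - apply: measurable_funD => //; apply: measurable_funD;
      exact: measurable_funM.
  - exact: ltW.
  - rewrite cI0 cI1 /=; have := ler_norm (B - `|y|); rewrite distrC.
    by clear -R; lra.
rewrite !mul1e adde0 => p01.
have [E0|E0] := leP (B / 2)%R%:E ('E_(f _ I)[agent_cost I 0%R])%E.
(* Voter 0 loses, so voter 1 is weakened; serving voter 0 at the point 0 then costs [3 / 4 * B] in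
   total. *)
- pose J := voters (q _ h2) (q _ h0) (q _ h3).
  have SCJ y : SC J y =
      `|y| + `| `|y| - 3 / 4 * B | + `| `|B / 2 - y| - B / 2 |.
    by rewrite SC_voters/= subr0 normr_id.
  have cJ y : agent_cost J 1 y = `| `|y| - 3 / 4 * B |.
    exact: agent_cost_voter1.
  exists 3%N, J; split => //.
  apply: (@le_trans _ _ (3 / 4 * B + B / 100)%:E).
    rewrite lee_fin; have := OPT_le J 0.
    rewrite SCJ normr0 !(sub0r, subr0) normrN (gtr0_norm hB2).
    by rewrite subrr normr0 gtr0_norm; lra.
  apply: (@weak_opponent_bound _ _ _ _ I _ 0 1 (q _ h4)) => //.
  + by rewrite misreport_voter1.
  + by move=> y; rewrite cJ cI0 SCI; have [] := ineqs y.
  + by move=> y; rewrite cJ SCJ; have [] := ineqs y.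
(* The expected cost of voter 0 is finite here and can be subtracted from [p01]. *)
- have E1 : ((B / 2)%:E <= 'E_(f _ I)[agent_cost I 1%R])%E.
    have := expectation_ge0 (f _ I) (@agent_cost_ge0 R B 3 I 0).
    case: ('E_(f _ I)[agent_cost I 0%R])%E E0 p01 => [u|//|//].
    case: ('E_(f _ I)[agent_cost I 1%R])%E => [v|_ _ _|//]; last by rewrite leey.
    by rewrite -EFinD !lee_fin lte_fin; lra.
  (* Now voter 0 is weakened, and the point [B] has social cost [3 / 4 * B]. *)
  pose J := voters (q _ h2) (q _ h1) (q _ h4).
  have SCJ y : SC J y = `| `|y| - B / 4 | + `| `|y| - B |
    + `| `|B / 2 - y| - B / 2 | by exact: SC_voters.
  have cJ y : agent_cost J 0 y = `| `|y| - B / 4 |.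
    exact: agent_cost_voter0.
  exists 3%N, J; split => //.
  apply: (@le_trans _ _ (3 / 4 * B + B / 100)%:E).
    rewrite lee_fin; have := OPT_le J B; rewrite SCJ (gtr0_norm hB) subrr normr0.
    rewrite (_ : B / 2 - B = - (B / 2)); last by lra.
    by rewrite normrN (gtr0_norm hB2) subrr normr0 gtr0_norm; lra.
  apply: (@weak_opponent_bound _ _ _ _ I _ 1 0 (q _ h0)) => //.
  + by rewrite misreport_voter0.
  + by move=> y; rewrite cJ cI1 SCI; have [] := ineqs y.
  + by move=> y; rewrite cJ SCJ; have [] := ineqs y.
Qed.
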